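(* Let $G$ be a finite graph (loopless, possibly with multiple edges). Then $\check{s}(G)\le 3$ if and only if there exists a decomposition of $G$ into at most four Class 1 regular subgraphs $H_0,H_1,H_2,H_3$ (any of which may be absent from the decomposition) with the following properties: - $H_0$, if present, is spanning; - there exists a partition of $V(G)$ into at most three subsets $A_1,A_2,A_3$ (some of which may be empty) such that $V(H_1)=A_2\cup A_3$ (if $H_1$ is present), $V(H_2)=A_1\cup A_3$ (if $H_2$ is present), and either $V(H_3)=A_3$ or $V(H_3)=A_1\cup A_2$ (if $H_3$ is present).
   Context: A $k$-edge-coloring of $G$ is a map $c\colon E(G)\to\{1,\dots,k\}$ such that any two distinct edges sharing an endpoint receive different colors. The palette of a vertex $v$ with respect to $c$ is $P_c(v)=\{c(e): e \text{ incident with } v\}$ (empty if $v$ is isolated). The palette index $\check{s}(G)$ is the minimum, over all edge-colorings $c$ of $G$ (with any number of colors), of the number of distinct palettes $P_c(v)$, $v\in V(G)$. A graph with maximum degree $\Delta$ is Class 1 if it admits a $\Delta$-edge-coloring; so an $r$-regular graph is Class 1 iff it admits an $r$-edge-coloring. A decomposition of $G$ is a family $\{H_i\}$ of subgraphs of $G$, each with nonempty edge set, whose edge sets are pairwise disjoint and have union $E(G)$. A subgraph is spanning if its vertex set is $V(G)$. *)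

(* Defs.v *)
From Stdlib Require List.
From mathcomp Require Import all_boot.
From mathcomp Require Import boolp.

Set Implicit Arguments.
Unset Strict Implicit.
Unset Printing Implicit Defensive.

(* Edges form a type of their own, so distinct edges may have the same ends;
   two distinct ends per edge means that there are no loops. *)
Record mgraph : Type := MGraph {
  vertex : finType;
  edge : finType;
  ends : edge -> {set vertex};
  card_ends : forall e, #|ends e| = 2 }.

Definition degree (G : mgraph) (v : vertex G) : nat :=
  #|[set e : edge G | v \in ends e]|.

Definition max_degree (G : mgraph) : nat := \max_(v : vertex G) degree v.

Definition regular (G : mgraph) : Prop :=
  exists r, forall v : vertex G, degree v = r.

(* The colours 1, ..., k are represented by 'I_k. *)
Definition edge_coloring (G : mgraph) (k : nat) (c : edge G -> 'I_k) : Prop :=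
  forall e f : edge G,
    e != f -> ends e :&: ends f != set0 -> c e != c f.

Definition class1 (G : mgraph) : Prop :=
  exists c : edge G -> 'I_(max_degree G), edge_coloring c.

Definition palette (G : mgraph) (k : nat) (c : edge G -> 'I_k)
    (v : vertex G) : {set 'I_k} :=
  [set c e | e : edge G & v \in ends e].

Definition num_palettes (G : mgraph) (k : nat) (c : edge G -> 'I_k) : nat :=
  #|[set palette c v | v : vertex G]|.

Definition realizes_palettes (G : mgraph) (m : nat) : Prop :=
  exists (k : nat) (c : edge G -> 'I_k),
    edge_coloring c /\ num_palettes c = m.

Lemma ex_realizes_palettes (G : mgraph) :
  exists m, `[< realizes_palettes G m >].
Proof.
exists (num_palettes (@enum_rank (edge G))); apply/asboolP.
exists #|edge G|, (@enum_rank (edge G)); split=> // e f ef _.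
by apply: contra ef => /eqP/enum_rank_inj ->.
Qed.

Definition palette_index (G : mgraph) : nat := ex_minn (ex_realizes_palettes G).

Lemma palette_indexP (G : mgraph) :
  realizes_palettes G (palette_index G) /\
  (forall m, realizes_palettes G m -> palette_index G <= m).
Proof.
rewrite /palette_index; case: ex_minnP => m /asboolP mG min_m; split=> // n nG.
by apply: min_m; apply/asboolP.
Qed.

Record subgraph (G : mgraph) : Type := Subgraph {
  sub_vertices : {set vertex G};
  sub_edges : {set edge G};
  sub_closed : forall e, e \in sub_edges -> ends e \subset sub_vertices }.

Section SubgraphAsGraph.
Variables (G : mgraph) (H : subgraph G).

Definition sub_ends (e : {e : edge G | e \in sub_edges H}) :
    {set {v : vertex G | v \in sub_vertices H}} :=
  [set v | val v \in ends (val e)].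

Lemma card_sub_ends e : #|sub_ends e| = 2.
Proof.
rewrite -(card_ends (val e)) -(card_imset _ val_inj); apply: eq_card => v.
apply/imsetP/idP => [[u + ->]|ve]; first by rewrite inE.
have vH := subsetP (sub_closed (valP e)) _ ve.
by exists (exist _ v vH); rewrite ?inE.
Qed.

Definition graph_of_subgraph : mgraph := MGraph card_sub_ends.

End SubgraphAsGraph.

Coercion graph_of_subgraph : subgraph >-> mgraph.

Definition spanning (G : mgraph) (H : subgraph G) : Prop :=
  sub_vertices H = [set: vertex G].

Definition decomposition (G : mgraph) (Hs : seq (subgraph G)) : Prop :=
  [/\ all (fun H => sub_edges H != set0) Hs,
      pairwise (fun H K => [disjoint sub_edges H & sub_edges K]) Hs
    & \bigcup_(H <- Hs) sub_edges H = [set: edge G]].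

(* Unlike [partition] of finset, the parts may be empty. *)
Definition partition3 (T : finType) (A1 A2 A3 : {set T}) : Prop :=
  [/\ A1 :|: A2 :|: A3 = [set: T],
      [disjoint A1 & A2], [disjoint A1 & A3] & [disjoint A2 & A3]].

(* Main.v *)
(* From left to right, take a colouring with at most three palettes that uses
   the fewest colours, and let V_a be the set of vertices seeing the colour a.
   If V_a and V_b were disjoint, b could be replaced by a; hence the sets V_a are
   pairwise intersecting. They are unions of the classes A_1, A_2, A_3 of vertices
   with equal palettes, so either one of them is a single class, say A_3, and all
   of them contain A_3, or none of them is a single class; in both cases only four
   sets V_a are possible, and the edges whose colours share the same V_a form a
   Class 1 regular subgraph on V_a. From right to left, colour the subgraphs with
   disjoint sets of colours: each vertex of a Class 1 regular subgraph sees all its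
   colours, so the palette of a vertex depends only on its class. *)
Require Import Defs.
From Stdlib Require List.
From mathcomp Require Import all_boot.
From mathcomp Require Import boolp.

Set Implicit Arguments.
Unset Strict Implicit.
Unset Printing Implicit Defensive.

(** * Palettes in regular Class 1 graphs *)

Lemma ends_neq0 (G : mgraph) (e : edge G) : exists v, v \in ends e.
Proof. by apply/set0Pn; rewrite -card_gt0 card_ends. Qed.

Lemma mem_palette (G : mgraph) k (c : edge G -> 'I_k) e v :
  v \in ends e -> c e \in palette c v.
Proof. by move=> ve; apply: imset_f; rewrite inE. Qed.

Lemma edge_coloring_inj (G : mgraph) k (c : edge G -> 'I_k) v e f :
  edge_coloring c -> v \in ends e -> v \in ends f -> c e = c f -> e = f.
Proof.
move=> cP ve vf cef; apply/eqP/negPn/negP => ef.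
have /(cP e f ef) : ends e :&: ends f != set0.
  by apply/set0Pn; exists v; rewrite inE ve.
by rewrite cef eqxx.
Qed.

Lemma card_palette (G : mgraph) k (c : edge G -> 'I_k) v :
  edge_coloring c -> #|palette c v| = degree v.
Proof.
move=> cP; rewrite /palette /degree; apply: card_in_imset => e f.
by rewrite !inE; apply: edge_coloring_inj.
Qed.

Lemma max_degree_const (G : mgraph) r :
  (forall v : vertex G, degree v = r) -> vertex G -> max_degree G = r.
Proof.
move=> rG v0; apply/eqP; rewrite eqn_leq; apply/andP; split.
  by apply/bigmax_leqP => v _; rewrite rG.
by rewrite -(rG v0); apply: (leq_bigmax v0).
Qed.

(** A palette has as many colours as its vertex has edges, which by regularity is the number of all
    available colours. *)
Lemma regular_palette_full (G : mgraph) (c : edge G -> 'I_(max_degree G)) v :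
  edge_coloring c -> regular G -> palette c v = setT.
Proof.
move=> cP [r rG]; apply/eqP; rewrite eqEcard subsetT cardsT card_ord.
by rewrite (card_palette v cP) rG (max_degree_const rG v) leqnn.
Qed.

(** Every degree equals the size of the common palette [D], and all colours lie in [D]; renumbering
    them by their positions in [enum D] leaves exactly maximum degree many. Without vertices there
    is no [D], but no edges either. *)
Lemma const_palette_class1 (G : mgraph) k (c : edge G -> 'I_k) :
  edge_coloring c -> (forall v w, palette c v = palette c w) ->
  class1 G /\ regular G.
Proof.
move=> cP cst; case: (pickP (@predT (vertex G))) => [v0 _|noV]; last first.
  split; last by exists 0 => v; have := noV v.
  have noE (e : edge G) : False by have [v _] := ends_neq0 e; have := noV v.
  by exists (fun e => False_rect _ (noE e)) => e.
set D := palette c v0.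
have dG (v : vertex G) : degree v = #|D| by rewrite -(card_palette v cP) (cst v v0).
split; last by exists #|D|.
have cD e : c e \in D by have [v ve] := ends_neq0 e; rewrite /D (cst _ v) mem_palette.
have ltD e : index (c e) (enum D) < #|D| by rewrite cardE index_mem mem_enum.
rewrite /class1 (max_degree_const dG v0).
exists (fun e => Ordinal (ltD e)) => e f ef adj.
apply: contra (cP e f ef adj) => /eqP[] /(congr1 (nth (c e) (enum D))).
by rewrite !nth_index ?mem_enum // => ->.
Qed.

(** * Colourings with pairwise intersecting colour supports *)

Definition color_support (G : mgraph) k (c : edge G -> 'I_k) (a : 'I_k) :
    {set vertex G} :=
  [set v | a \in palette c v].

Lemma color_support_neq0 (G : mgraph) k (c : edge G -> 'I_k) e :
  color_support c (c e) != set0.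
Proof.
by have [v ve] := ends_neq0 e; apply/set0Pn; exists v; rewrite inE mem_palette.
Qed.

(** No vertex sees both colours, so replacing [c f] by [c e] creates no conflict, and the colour
    [c f] disappears. *)
Lemma merge_colors (G : mgraph) k (c : edge G -> 'I_k) e f :
  edge_coloring c -> color_support c (c e) :&: color_support c (c f) = set0 ->
  exists c' : edge G -> 'I_k, [/\ edge_coloring c',
    num_palettes c' <= num_palettes c & #|codom c'| < #|codom c|].
Proof.
move=> cP dis; pose m a := if a == c f then c e else a.
have cef : c e != c f.
  by apply: contra (color_support_neq0 c e) => /eqP ef; rewrite -dis -ef setIid.
have excl v : c e \in palette c v -> c f \in palette c v -> False.
  by move=> ve vf; have := in_set0 v; rewrite -dis !inE ve vf.
exists (m \o c); split.
- move=> g h gh /[dup] adj /(cP g h gh) cgh; case/set0Pn: adj => v.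
  rewrite inE => /andP[/(mem_palette c) vg /(mem_palette c) vh].
  rewrite /= /m; case: ifPn => [/eqP g1|_]; case: ifPn => [/eqP h1|_] //.
  + by move: cgh; rewrite g1 h1 eqxx.
  + by apply/eqP => h2; apply: (excl v); rewrite ?h2 // -g1.
  + by apply/eqP => g2; apply: (excl v); rewrite -?g2 // -h1.
- rewrite /num_palettes.
  (* The new palettes are the images of the old ones under [m], so their number cannot grow. *)
  have -> : [set palette (m \o c) v | v : vertex G] =
            (fun P : {set 'I_k} => m @: P) @: [set palette c v | v : vertex G].
    rewrite -imset_comp; apply: eq_imset => v /=.
    by rewrite /palette -imset_comp.
  exact: leq_imset_card.
- apply/proper_card/properP; split.
    apply/subsetP => _ /codomP[g ->] /=; rewrite /m.
    by case: ifP => _; apply: codom_f.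
  exists (c f); first exact: codom_f.
  apply/codomP => -[g] /=; rewrite /m.
  by case: (eqVneq (c g) (c f)) => [_ /eqP|/eqP ne /esym //]; rewrite eq_sym (negPf cef).
Qed.

Lemma intersecting_coloring (G : mgraph) :
  palette_index G <= 3 ->
  exists k (c : edge G -> 'I_k), [/\ edge_coloring c, num_palettes c <= 3 &
    forall e f, color_support c (c e) :&: color_support c (c f) != set0].
Proof.
have [[k [c [cP <-]]] _] := palette_indexP G; exists k.
(* The induction is on the number of colours that occur; [k] itself does not change when colours are
   merged. *)
have [n] := ubnP #|codom c|; elim: n c cP H => // n IHn c cP c3 lt_c.
case: (pselect (exists e f, color_support c (c e) :&: color_support c (c f) = set0)).
  move=> [e [f /(merge_colors cP)[c' [c'P le' lt']]]].
  by apply: (IHn c') => //; [apply: leq_trans le' c3 | apply: leq_trans lt' _].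
by move=> no; exists c; split=> // e f; apply/eqP => ef; apply: no; exists e, f.
Qed.

(** * Intersecting families of unions of three classes *)

(** The fibres are numbered by the position of their value in the enumeration of the image;
    positions beyond its end give empty parts. *)
Lemma partition3_fibers (T T' : finType) (f : T -> T') :
  #|[set f x | x : T]| <= 3 ->
  exists A1 A2 A3 : {set T}, partition3 A1 A2 A3 /\
    forall A, A \in [:: A1; A2; A3] -> {in A &, forall x y, f x = f y}.
Proof.
move=> f3; pose l x := index (f x) (enum [set f x | x : T]).
have l3 x : l x < 3.
  by apply: leq_trans f3; rewrite cardE index_mem mem_enum imset_f.
have l_inj x y : l x = l y -> f x = f y.
  by apply: (@index_inj _ (f x) (enum [set f x | x : T])); rewrite ?mem_enum ?imset_f.
exists [set x | l x == 0], [set x | l x == 1], [set x | l x == 2]; split.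
  split; first by apply/setP => x; rewrite !inE; case: (l x) (l3 x) => [|[|[]]].
  - by rewrite -setI_eq0; apply/eqP/setP => x; rewrite !inE; case: (l x) => [|[|[]]].
  - by rewrite -setI_eq0; apply/eqP/setP => x; rewrite !inE; case: (l x) => [|[|[]]].
  - by rewrite -setI_eq0; apply/eqP/setP => x; rewrite !inE; case: (l x) => [|[|[]]].
move=> A; rewrite !inE => /or3P[] /eqP-> x y; rewrite !inE => /eqP xl /eqP yl.
- by apply: l_inj; rewrite xl yl.
- by apply: l_inj; rewrite xl yl.
- by apply: l_inj; rewrite xl yl.
Qed.

Lemma partition3_cycle (T : finType) (A1 A2 A3 : {set T}) :
  partition3 A1 A2 A3 -> partition3 A2 A3 A1.
Proof.
move=> [UA d12 d13 d23]; split=> //; last 2 first.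
- by rewrite disjoint_sym.
- by rewrite disjoint_sym.
by rewrite setUC setUA.
Qed.

Definition unions3 (T : finType) (A1 A2 A3 : {set T}) : seq {set T} :=
  [:: set0; A1; A2; A3; A1 :|: A2; A1 :|: A3; A2 :|: A3; setT].

Lemma unions3_cycle (T : finType) (A1 A2 A3 S : {set T}) :
  S \in unions3 A1 A2 A3 -> S \in unions3 A2 A3 A1.
Proof.
by rewrite !inE (setUC A2 A1) (setUC A3 A1) => /or4P[|||/or4P[||| /orP[]]] ->;
   rewrite ?orbT.
Qed.

(** Each class lies inside [S] or misses it, so [S] is the union of the classes it contains. *)
Lemma mem_unions3 (T : finType) (A1 A2 A3 S : {set T}) :
  partition3 A1 A2 A3 ->
  (forall A, A \in [:: A1; A2; A3] ->
     {in A &, forall x y, (x \in S) = (y \in S)}) ->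
  S \in unions3 A1 A2 A3.
Proof.
move=> [UA _ _ _] SA.
have sub A : A \in [:: A1; A2; A3] -> S :&: A = A \/ S :&: A = set0.
  move=> AA; case: (set_0Vmem (S :&: A)) => [|[x]]; first by right.
  rewrite inE => /andP[xS xA]; left; apply/setIidPr/subsetP => y yA.
  by rewrite (SA A AA y x).
have -> : S = (S :&: A1) :|: (S :&: A2) :|: (S :&: A3).
  by rewrite -!setIUr UA setIT.
have s1 : S :&: A1 = A1 \/ S :&: A1 = set0 by apply: sub; rewrite !inE eqxx.
have s2 : S :&: A2 = A2 \/ S :&: A2 = set0 by apply: sub; rewrite !inE eqxx orbT.
have s3 : S :&: A3 = A3 \/ S :&: A3 = set0 by apply: sub; rewrite !inE eqxx !orbT.
by case: s1 => ->; case: s2 => ->; case: s3 => ->;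
   rewrite ?UA ?set0U ?setU0 !inE eqxx ?orbT.
Qed.

(** A union of classes that omits [A3] is disjoint from it; the four listed sets are those that
    include it. *)
Lemma intersecting_star3 (T : finType) (A1 A2 A3 : {set T}) (F : {set {set T}}) :
  partition3 A1 A2 A3 -> {in F, forall S, S \in unions3 A1 A2 A3} ->
  {in F &, forall S S', S :&: S' != set0} -> A3 \in F ->
  {in F, forall S, S \in [:: setT; A2 :|: A3; A1 :|: A3; A3]}.
Proof.
move=> [_ _ d13 d23] FU FI F3 S SF; have := FI _ _ SF F3; have := FU _ SF.
move: d13 d23; rewrite -!setI_eq0 => /eqP d13 /eqP d23.
rewrite !inE => /or4P[|||/or4P[|||/orP[]]] /eqP->;
  by rewrite ?eqxx ?orbT ?set0I ?setIUl ?d13 ?d23 ?setU0 ?eqxx.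
Qed.

(** If some class belongs to [F], a cyclic renaming makes it [B3] and the star case applies.
    Otherwise only unions of two classes and the whole set remain. *)
Lemma intersecting_unions3 (T : finType) (A1 A2 A3 : {set T}) (F : {set {set T}}) :
  partition3 A1 A2 A3 -> {in F, forall S, S \in unions3 A1 A2 A3} ->
  {in F &, forall S S', S :&: S' != set0} ->
  exists B1 B2 B3 S3, [/\ partition3 B1 B2 B3, S3 = B3 \/ S3 = B1 :|: B2 &
    {in F, forall S, S \in [:: setT; B2 :|: B3; B1 :|: B3; S3]}].
Proof.
move=> pA FU FI; have pA' := partition3_cycle pA; have pA'' := partition3_cycle pA'.
have FU' : {in F, forall S, S \in unions3 A2 A3 A1}.
  by move=> S /FU /unions3_cycle.
have FU'' : {in F, forall S, S \in unions3 A3 A1 A2}.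
  by move=> S /FU' /unions3_cycle.
case: (boolP (A3 \in F)) => F3.
  by exists A1, A2, A3, A3; split; [|left|apply: intersecting_star3].
case: (boolP (A1 \in F)) => F1.
  by exists A2, A3, A1, A1; split; [|left|apply: intersecting_star3].
case: (boolP (A2 \in F)) => F2.
  by exists A3, A1, A2, A2; split; [|left|apply: intersecting_star3].
exists A1, A2, A3, (A1 :|: A2); split; [by []|by right|move=> S SF].
(* Intersecting [S] with itself rules out the empty set. *)
have := FI _ _ SF SF; rewrite setIid => S0; have := FU _ SF.
rewrite !inE => /or4P[|||/or4P[|||/orP[]]] /eqP SE; rewrite SE ?eqxx ?orbT //.
- by rewrite SE eqxx in S0.
- by rewrite SE (negPf F1) in SF.
- by rewrite SE (negPf F2) in SF.
- by rewrite SE (negPf F3) in SF.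
Qed.

(** * From a colouring to regular Class 1 subgraphs *)

Section ColorSupportSubgraphs.
Variables (G : mgraph) (k : nat) (c : edge G -> 'I_k) (S : nat -> {set vertex G}).
Variable t : 'I_k -> nat.
Hypothesis cP : edge_coloring c.
Hypothesis tP : forall e, color_support c (c e) = S (t (c e)).

Lemma color_class_closed i e :
  e \in [set e | t (c e) == i] -> ends e \subset S i.
Proof.
rewrite inE => /eqP<-; rewrite -tP; apply/subsetP => v ve.
by rewrite inE mem_palette.
Qed.

Definition color_subgraph i : subgraph G := Subgraph (@color_class_closed i).

(** Each vertex of [S i] sees exactly the occurring colours of index [i], because [S i] is the
    support of each of them; hence all palettes in the subgraph agree. *)
Lemma color_subgraph_class1 i : class1 (color_subgraph i) /\ regular (color_subgraph i).
Proof.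
apply: (@const_palette_class1 (color_subgraph i) k (c \o val)).
  move=> e f ef /set0Pn[v]; rewrite !inE => /andP[ve vf]; apply: cP => //.
  by apply/set0Pn; exists (val v); rewrite inE ve.
suff pal (v : vertex (color_subgraph i)) :
    palette (G := color_subgraph i) (c \o val) v =
    [set a | (t a == i) && [exists e, c e == a]].
  by move=> v w; rewrite !pal.
apply/setP => a; rewrite inE; apply/imsetP/andP => [[e _ ->]|[ta /existsP[e /eqP ea]]].
  by have := valP e; rewrite inE; split=> //; apply/existsP; exists (val e).
have : val v \in color_support c (c e) by rewrite tP ea (eqP ta) (valP v).
rewrite inE => /imsetP[f]; rewrite inE => vf ef; have fi : f \in sub_edges (color_subgraph i).
  by rewrite inE -ef ea.
by exists (exist _ f fi) => //; rewrite ?inE //= -?ef.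
Qed.

(** Members of a decomposition must have edges, so an empty colour class counts as an absent
    subgraph. *)
Definition color_subgraph_opt i : option (subgraph G) :=
  if sub_edges (color_subgraph i) == set0 then None else Some (color_subgraph i).

Lemma color_subgraph_optP i H : color_subgraph_opt i = Some H -> H = color_subgraph i.
Proof. by rewrite /color_subgraph_opt; case: ifP => // _ []. Qed.

Lemma In_color_subgraphs H s :
  List.In H (pmap color_subgraph_opt s) -> exists i, H = color_subgraph i.
Proof.
elim: s => //= i s IHs; case Hi: (color_subgraph_opt i) => [K|] //=.
by case=> [<-|//]; exists i; apply: color_subgraph_optP.
Qed.

Lemma color_subgraph_decomposition s :
  uniq s -> (forall e, t (c e) \in s) -> decomposition (pmap color_subgraph_opt s).
Proof.
move=> s_uniq st; split.
- rewrite all_pmap; apply/allP => i _ /=.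
  by rewrite /color_subgraph_opt; case: ifPn.
- elim: s s_uniq {st} => //= i s IHs /andP[si /IHs pw].
  case Hi: (color_subgraph_opt i) => [K|] //=.
  rewrite pw andbT (color_subgraph_optP Hi) all_pmap; apply/allP => j sj /=.
  case Hj: (color_subgraph_opt j) => [L|] //=; rewrite (color_subgraph_optP Hj).
  rewrite -setI_eq0; apply/eqP/setP => e; rewrite !inE.
  by apply/andP => -[/eqP-> /eqP ij]; rewrite ij sj in si.
- rewrite big_pmap; apply/setP => e; rewrite inE (big_rem _ (st e)) /= inE.
  apply/orP; left; rewrite /color_subgraph_opt; case: ifPn => [/eqP E0|_] /=.
    by have := in_set0 e; rewrite -E0 inE eqxx.
  by rewrite inE.
Qed.

End ColorSupportSubgraphs.

(** * From a decomposition to a colouring with few palettes *)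

(* The colours are edges of [H] itself, so colourings of edge-disjoint subgraphs
   automatically use disjoint sets of colours. *)
Definition own_edge_coloring (G : mgraph) (H : subgraph G)
    (d : edge G -> edge G) : Prop :=
  [/\ {in sub_edges H, forall e, d e \in sub_edges H},
      {in sub_edges H &, forall e f v, v \in ends e -> v \in ends f ->
         d e = d f -> e = f}
    & forall v e, v \in sub_vertices H -> e \in sub_edges H ->
        exists f, [/\ f \in sub_edges H, v \in ends f & d f = d e]].

Lemma class1_own_edge_coloring (G : mgraph) (H : subgraph G) :
  sub_edges H != set0 -> class1 H -> regular H ->
  exists d, own_edge_coloring H d.
Proof.
case/set0Pn => e0 e0H [c cP] Hreg; have [v0 v0e] := ends_neq0 e0.
have v0H : v0 \in sub_vertices H by apply: (subsetP (sub_closed e0H)).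
(* The colour [a] is represented by the edge of that colour at [v0]. *)
pose w0 : vertex H := exist _ v0 v0H.
have seen (v : vertex H) a : exists e : edge H, v \in ends e /\ c e = a.
  have : a \in palette c v by rewrite regular_palette_full ?inE.
  by case/imsetP => e; rewrite inE => ve ->; exists e.
have [g gP] := choice (seen w0).
pose d e := if insub e is Some e' then val (g (c e')) else e.
have dE (e : edge H) : d (val e) = val (g (c e)) by rewrite /d valK.
have liftE e (eH : e \in sub_edges H) : e = val (exist _ e eH : edge H) by [].
exists d; split.
- by move=> e eH; rewrite (liftE e eH) dE; apply: valP.
- move=> e f eH fH v ve vf; rewrite (liftE e eH) (liftE f fH) !dE => /val_inj gg.
  congr val; have vH : v \in sub_vertices H by apply: (subsetP (sub_closed eH)).
  apply: (@edge_coloring_inj H _ c (exist _ v vH : vertex H)); rewrite ?inE //.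
  by rewrite -(gP (c (exist _ e eH))).2 gg (gP _).2.
- move=> v e vH eH; have [f [vf cf]] := seen (exist _ v vH) (c (exist _ e eH)).
  exists (val f); split; first exact: valP.
    by move: vf; rewrite inE.
  by rewrite (liftE e eH) !dE cf.
Qed.

Lemma pairwise_disjoint_inj (G : mgraph) (Hs : seq (subgraph G)) H K e :
  pairwise (fun H K => [disjoint sub_edges H & sub_edges K]) Hs ->
  List.In H Hs -> List.In K Hs -> e \in sub_edges H -> e \in sub_edges K -> H = K.
Proof.
have all_In (p : pred (subgraph G)) s L : all p s -> List.In L s -> p L.
  by elim: s => //= M s IHs /andP[pM /IHs ps] [<-|].
elim: Hs => //= L Hs IHs /andP[disj /IHs{}IHs] [<-|HL] [<-|KL] // eH eK.
- by have := disjointFr (all_In _ _ _ disj KL) eH; rewrite eK.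
- by have := disjointFr (all_In _ _ _ disj HL) eK; rewrite eH.
- exact: IHs.
Qed.

Lemma In_pmap_id (T : Type) (s : seq (option T)) x :
  List.In x (pmap id s) -> List.In (Some x) s.
Proof. by elim: s => //= -[y|] s IHs /=; [case=> [->|/IHs]|move/IHs]; auto. Qed.

Lemma bigcup_In (G : mgraph) (Hs : seq (subgraph G)) e :
  e \in \bigcup_(H <- Hs) sub_edges H -> exists H, List.In H Hs /\ e \in sub_edges H.
Proof.
elim: Hs => [|H Hs IHs]; first by rewrite big_nil inE.
rewrite big_cons inE => /orP[eH|/IHs[K [KHs eK]]]; first by exists H; split; [left|].
by exists K; split; [right|].
Qed.

(** Numbering the colours by [enum_rank] carries the bound over to any finite type of colours, in
    particular to edges used as colours. *)
Lemma palette_index_finite_colors (G : mgraph) (C : finType) (c : edge G -> C) :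
  (forall e f v, v \in ends e -> v \in ends f -> c e = c f -> e = f) ->
  palette_index G <= #|[set [set c e | e : edge G & v \in ends e] | v : vertex G]|.
Proof.
move=> cP; have [_ minG] := palette_indexP G.
pose c' e := enum_rank (c e).
have c'P : edge_coloring c'.
  move=> e f ef /set0Pn[v]; rewrite inE => /andP[ve vf].
  by apply: contra ef => /eqP/enum_rank_inj/(cP _ _ _ ve vf)->.
apply: (leq_trans (minG (num_palettes c') _)); first by exists #|C|, c'.
rewrite /num_palettes.
have -> : [set palette c' v | v : vertex G] = (fun P : {set C} => enum_rank @: P) @:
    [set [set c e | e : edge G & v \in ends e] | v : vertex G].
  by rewrite -imset_comp; apply: eq_imset => v /=; rewrite -imset_comp.
exact: leq_imset_card.
Qed.

(** A vertex sees all the colours of each subgraph containing it and no others. The label [l v]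
    determines these subgraphs, hence the palette. *)
Lemma decomposition_palette_index (G : mgraph) (Hs : seq (subgraph G))
    (I : finType) (l : vertex G -> I) :
  decomposition Hs -> (forall H, List.In H Hs -> class1 H /\ regular H) ->
  (forall H, List.In H Hs ->
     forall v w, l v = l w -> v \in sub_vertices H -> w \in sub_vertices H) ->
  palette_index G <= #|I|.
Proof.
move=> [Hs0 Hsd HsU] HsC Hsl.
have edgeH e : exists H, List.In H Hs /\ e \in sub_edges H.
  by apply: bigcup_In; rewrite HsU inE.
have [h hP] := choice edgeH.
(* The choice of [d] ranges over all subgraphs, so those outside [Hs] receive the dummy value
   [id]. *)
have recol H : exists d, List.In H Hs -> own_edge_coloring H d.
  case: (pselect (List.In H Hs)) => HH; last by exists id.
  have [H1 Hreg] := HsC H HH.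
  have H0 : sub_edges H != set0.
    elim: Hs Hs0 HH {Hsd HsU HsC Hsl edgeH h hP} => //= K s IHs /andP[K0 s0].
    by case=> [<-|/IHs]; last apply.
  by have [d dP] := class1_own_edge_coloring H0 H1 Hreg; exists d.
have [d dP] := choice recol.
pose c e := d (h e) e.
have cH e : c e \in sub_edges (h e).
  by have [hH eh] := hP e; have [dH _ _] := dP _ hH; apply: dH.
have hE e H : List.In H Hs -> e \in sub_edges H -> h e = H.
  by have [hH eh] := hP e => HH; apply: (pairwise_disjoint_inj Hsd hH HH eh).
have cP e f v : v \in ends e -> v \in ends f -> c e = c f -> e = f.
  have [hH eh] := hP e; have [hH' fh] := hP f => ve vf cef.
  (* The common colour is an edge of both [h e] and [h f], and distinct members share no edge. *)
  have hef : h e = h f.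
    by apply: (pairwise_disjoint_inj Hsd hH hH' (cH e)); rewrite cef.
  have [_ dI _] := dP _ hH; apply: (dI e f) ve vf _ => //; first by rewrite hef.
  by move: cef; rewrite /c -hef.
have palS v w : l v = l w -> [set c e | e : edge G & v \in ends e] \subset
                             [set c e | e : edge G & w \in ends e].
  move=> lvw; apply/subsetP => _ /imsetP[e + ->]; rewrite inE => ve.
  have [hH eh] := hP e; have [_ _ dX] := dP _ hH.
  have wH : w \in sub_vertices (h e).
    by apply: (Hsl _ hH v w lvw); apply: (subsetP (sub_closed eh)).
  have [f [fH wf df]] := dX w e wH eh.
  by apply/imsetP; exists f; rewrite ?inE // /c (hE f _ hH fH) df.
apply: (leq_trans (palette_index_finite_colors cP)).
(* [P] sends a label to the palette of some vertex carrying it, so every palette lies in the image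
   of [I]. *)
pose P i := if [pick v | l v == i] is Some v
            then [set c e | e : edge G & v \in ends e] else set0.
rewrite -cardsT; apply: leq_trans (leq_imset_card P [set: I]).
apply/subset_leq_card/subsetP => _ /imsetP[v _ ->]; apply/imsetP; exists (l v) => //.
rewrite /P; case: pickP => [w /eqP lw|/(_ v)]; last by rewrite eqxx.
by apply/eqP; rewrite eqEsubset !palS.
Qed.

Theorem theorem7 (G : mgraph) :
  palette_index G <= 3 <->
  exists H0 H1 H2 H3 : option (subgraph G),
    let Hs := pmap id [:: H0; H1; H2; H3] in
    [/\ decomposition Hs,
        (forall H : subgraph G, List.In H Hs -> class1 H /\ regular H),
        (forall H, H0 = Some H -> spanning H)
      & exists A1 A2 A3 : {set vertex G},
          [/\ partition3 A1 A2 A3,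
              (forall H, H1 = Some H -> sub_vertices H = A2 :|: A3),
              (forall H, H2 = Some H -> sub_vertices H = A1 :|: A3)
            & (forall H, H3 = Some H ->
                 sub_vertices H = A3 \/ sub_vertices H = A1 :|: A2)]].
Proof.
split.
  move=> /intersecting_coloring[k [c [cP c3 cI]]].
  have [A1 [A2 [A3 [pA cA]]]] := partition3_fibers c3.
  pose F := [set color_support c (c e) | e : edge G].
  have FU : {in F, forall S, S \in unions3 A1 A2 A3}.
    move=> _ /imsetP[e _ ->]; apply: mem_unions3 => // A /cA Ac v w vA wA.
    by rewrite !inE (Ac v w).
  have FI : {in F &, forall S S', S :&: S' != set0}.
    by move=> _ _ /imsetP[e _ ->] /imsetP[f _ ->].
  have [B1 [B2 [B3 [S3 [pB S3E FS]]]]] := intersecting_unions3 pA FU FI.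
  (* The order matches the vertex sets prescribed for [H0] to [H3]. When entries coincide, [index]
     takes the first, and the later subgraph is absent. *)
  pose Ss := [:: setT; B2 :|: B3; B1 :|: B3; S3].
  pose t a := index (color_support c a) Ss.
  have memS e : color_support c (c e) \in Ss by apply/FS/imset_f.
  have tP e : color_support c (c e) = nth set0 Ss (t (c e)) by rewrite nth_index.
  pose H := color_subgraph_opt tP.
  exists (H 0), (H 1), (H 2), (H 3); split.
  - apply: (@color_subgraph_decomposition _ _ _ _ _ tP (iota 0 4)) => // e.
    by have := memS e; rewrite mem_iota -index_mem.
  - move=> K /(@In_color_subgraphs _ _ _ _ _ tP K (iota 0 4))[i ->].
    exact: color_subgraph_class1.
  - by move=> K /color_subgraph_optP ->.
  - exists B1, B2, B3; split=> // K /color_subgraph_optP -> //=.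
move=> [H0 [H1 [H2 [H3 [dec HC HS [A1 [A2 [A3 [pA HA1 HA2 HA3]]]]]]]]].
(* The three values [None], [Some true] and [Some false] mark [A1], [A2] and [A3]. *)
pose l v := if v \in A1 then None else Some (v \in A2).
have -> : 3 = #|{: option bool}| by rewrite card_option card_bool.
apply: (decomposition_palette_index (l := l) dec HC) => H HH v w lvw.
have l1 : (v \in A1) = (w \in A1).
  by move: lvw; rewrite /l; case: (v \in A1); case: (w \in A1).
have [UA d12 d13 d23] := pA.
have l2 : (v \in A2) = (w \in A2).
  move: lvw; rewrite /l l1; case: ifP => [w1 _|_ [] //].
  by rewrite !(disjointFr d12) // l1.
have A3E x : (x \in A3) = ~~ ((x \in A1) || (x \in A2)).
  have := in_setT x; rewrite -UA !inE; case x1: (x \in A1).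
    by rewrite (disjointFr d13 x1).
  by case x2: (x \in A2) => //=; rewrite (disjointFr d23 x2).
(* Every allowed vertex set is a union of classes, so membership in it depends only on the label. *)
have S_cases : [\/ sub_vertices H = setT, sub_vertices H = A2 :|: A3,
    sub_vertices H = A1 :|: A3 | sub_vertices H = A3 \/ sub_vertices H = A1 :|: A2].
  case: (In_pmap_id HH) => [E|[E|[E|[E|[]]]]].
  - by apply: Or41; apply: HS.
  - by apply: Or42; apply: HA1.
  - by apply: Or43; apply: HA2.
  - by apply: Or44; apply: HA3.
by case: S_cases => [||| []] ->; rewrite ?inE ?A3E ?l1 ?l2.
Qed.
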